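(* Let $G$ be a finite graph. Suppose $\{0,1\}$-assignings $\alpha,\alpha'$ of $G$ satisfy $\alpha=\alpha_{G,b}$ and $\alpha'=\alpha_{G,b'}$ for locally zero-sum functions $b\in Z(G,A)$ and $b'\in Z(G,A')$, where $A,A'$ are finite Abelian groups. If $\alpha(X)\le\alpha'(X)$ for all $X\in\Lambda(G)$, then the signless coefficients of the assigning polynomials $F(G,\alpha;k)$ and $F(G,\alpha';k)$ satisfy \[ a_i(G,\alpha)\le a_i(G,\alpha')\quad\text{for } i=0,1,\ldots,m(G). \] In particular, $a_i(G,0)\le a_i(G,\alpha_{G,b})$ for all $b\in Z(G,A)$ and all $i=0,1,\ldots,m(G)$, where $0$ denotes the identically zero $\{0,1\}$-assigning.
   Context: Graphs are finite with vertex set $V(G)$ and edge set $E(G)$; multiple edges and loops are allowed. $c(G)$ is the number of connected components of $G$ (a graph with no vertices has $0$ components) and $m(G)=|E(G)|-|V(G)|+c(G)$. For $X\subseteq V(G)$, $G[X]$ and $G-X$ are the vertex-induced subgraphs on $X$ and $V(G)\setminus X$. Let $A$ be a finite additive Abelian group. Fix an arbitrary edge orientation of $G$. For $v\in V(G)$ let $E^+(v)$ (resp. $E^-(v)$) be the set of edges whose head (resp. tail) is $v$ (a loop at $v$ belongs to both). The boundary of $f\in A^{E(G)}$ is $\partial f\in A^{V(G)}$, $\partial f(v)=\sum_{e\in E^+(v)}f(e)-\sum_{e\in E^-(v)}f(e)$. For $b\in A^{V(G)}$, an $(A,b)$-flow is an $f\in A^{E(G)}$ with $\partial f=b$; it is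 nowhere-zero if $f(e)\neq 0$ for all $e\in E(G)$. $F^*(G,b;A)$ is the number of nowhere-zero $(A,b)$-flows of $G$ (independent of the orientation). $Z(G,A)$ is the set of locally zero-sum functions on $G$, i.e. all $b\in A^{V(G)}$ with $\sum_{v\in V(C)}b(v)=0$ for every connected component $C$ of $G$. $\Lambda(G)$ is the family of nonempty $X\subseteq V(G)$ such that $G[X]$ is connected and $c(G-X)=c(G)$. A $\{0,1\}$-assigning of $G$ is a map $\alpha:\Lambda(G)\to\{0,1\}$. Each $b\in A^{V(G)}$ induces the $\{0,1\}$-assigning $\alpha_{G,b}$ with $\alpha_{G,b}(X)=0$ if $\sum_{v\in X}b(v)=0$ and $\alpha_{G,b}(X)=1$ otherwise. By a theorem of Kochol, if $\alpha=\alpha_{G,b}$ for some finite Abelian group $A$ and $b\in Z(G,A)$, there is a (unique) polynomial $F(G,\alpha;k)$ in $k$, of degree at most $m(G)$, such that $F(G,\alpha;k)=F^*(G,b';A')$ for every Abelian group $A'$ of order $k$ and every $b'\in Z(G,A')$ with $\alpha_{G,b'}=\alpha$; it is called the $\alpha$-assigning polynomial of $G$. Its signless coefficients $a_i(G,\alpha)$ are defined by $F(G,\alpha;k)=\sum_{i=0}^{m(G)}(-1)^i a_i(G,\alpha)k^{m(G)-i}$. *)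

(* Defs.v *)
From Stdlib Require Import ClassicalEpsilon.
From mathcomp Require Import all_boot all_order all_algebra.

Set Implicit Arguments.
Unset Strict Implicit.
Unset Printing Implicit Defensive.

Import GRing.Theory.
Local Open Scope ring_scope.

(* A finite multigraph (loops and parallel edges allowed) together with an
   edge orientation; connectivity below ignores the orientation. *)
Record mgraph := MGraph {
  vertex : finType;
  edge : finType;
  ehead : edge -> vertex;
  etail : edge -> vertex }.

Section Graph.

Variable G : mgraph.

Local Notation V := (vertex G).
Local Notation E := (edge G).

(* Adjacency in the induced subgraph G[X]. *)
Definition adj_in (X : {set V}) : rel V := fun u v =>
  [&& u \in X, v \in X &
      [exists e : E, ((ehead e == u) && (etail e == v)) ||
                     ((ehead e == v) && (etail e == u))]].

(* Vertex sets of the connected components of G[X]. *)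
Definition components_in (X : {set V}) : {set {set V}} :=
  equivalence_partition (connect (adj_in X)) X.

Definition ncomp_in (X : {set V}) : nat := #|components_in X|.

Definition connected_in (X : {set V}) : bool :=
  [forall u in X, forall v in X, connect (adj_in X) u v].

(* |E| - |V| + c(G); the truncated subtraction is harmless because
   |V| <= |E| + c(G) in every graph. *)
Definition cyclomatic : nat := (#|E| + ncomp_in setT - #|V|)%N.

Definition Lambda : {set {set V}} :=
  [set X : {set V} | [&& X != set0, connected_in X &
                         ncomp_in (~: X) == ncomp_in setT]].

Definition assigning := {ffun {X : {set V} | X \in Lambda} -> bool}.

Definition assigning0 : assigning := [ffun=> false].

Section Flows.

Variable A : finZmodType.

Definition boundary (f : {ffun E -> A}) : {ffun V -> A} :=
  [ffun v => \sum_(e | ehead e == v) f e - \sum_(e | etail e == v) f e].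

Definition num_nz_flows (b : {ffun V -> A}) : nat :=
  #|[set f : {ffun E -> A} | (boundary f == b) && [forall e, f e != 0]]|.

Definition locally_zero_sum (b : {ffun V -> A}) : bool :=
  [forall C in components_in setT, \sum_(v in C) b v == 0].

Definition assigning_of (b : {ffun V -> A}) : assigning :=
  [ffun X : {X : {set V} | X \in Lambda} => \sum_(v in val X) b v != 0].

End Flows.

Definition is_assigning_poly (alpha : assigning) (p : {poly rat}) : Prop :=
  (size p <= cyclomatic.+1)%N /\
  forall (A : finZmodType) (b : {ffun V -> A}),
    locally_zero_sum b -> assigning_of b = alpha ->
    p.[#|A|%:R] = (num_nz_flows b)%:R.

(* When alpha is induced by a locally zero-sum function on some finite abelian
   group, exactly one polynomial satisfies is_assigning_poly alpha (Kochol);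
   otherwise the value is irrelevant. *)
Definition assigning_poly (alpha : assigning) : {poly rat} :=
  epsilon (inhabits 0) (is_assigning_poly alpha).

(* Meaningful for i <= cyclomatic only. *)
Definition signless_coef (alpha : assigning) (i : nat) : rat :=
  (-1) ^+ i * (assigning_poly alpha)`_(cyclomatic - i)%N.

End Graph.

(* Main.v *)
From HB Require Import structures.
From Stdlib Require Import ClassicalEpsilon.
Require Import Defs.
From mathcomp Require Import all_boot all_order all_algebra.
From mathcomp Require Import zify.

Set Implicit Arguments.
Unset Strict Implicit.
Unset Printing Implicit Defensive.

Import Order.TTheory GRing.Theory Num.Theory.
Local Open Scope ring_scope.

(** Write [Z(T)] for the functions whose sum vanishes on every component of the
    spanning subgraph [(V, T)].  A function [b] has [|A| ^ nullity T] flows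
    supported on [T] if [b] is in [Z(T)], and none otherwise ([card_flows_in]).
    Inclusion-exclusion over the support therefore counts the nowhere-zero
    flows by the polynomial [flow_poly b], the sum of
    [(-1) ^ |E \ T| X ^ nullity T] over the [T] with [b] in [Z(T)].

    To compare two such polynomials, restrict the sum to [C <= T <= U], that is,
    contract [C] and delete the complement of [U], and normalise the sign of
    each coefficient ([minor_coef]).  Let [e] be an edge of [U] outside [C].

    - If [e] is not a bridge of [U], contracting and deleting [e] give two
      contributions of the same sign, and they add up.
    - If [e] is a bridge of [U] and [b] has zero sum on both of its sides, the
      terms for [T] and for [T] with [e] added cancel, and everything is [0].
    - If [e] is a bridge and a side has nonzero sum, no term avoids [e] and
      only the contraction remains.

    By induction all signless coefficients are nonnegative.  The same induction
    shows that they can only grow when [b] is replaced by a [b'] with fewer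
    vanishing sums, since at a bridge the second case for [b'] forces the second
    case for [b] ([minor_coef_mono]).  Only non-bridges are ever deleted, so [U]
    keeps the connectivity of [G] and a side of a bridge of [U] is a member of
    [Lambda G] ([bridge_side_in_Lambda]): the order between the two assignings is
    precisely what the bridge case needs.

    Applied in both directions, monotonicity shows that [flow_poly b] depends
    only on the assigning induced by [b].  So [flow_poly b] is an assigning
    polynomial, and it is the only one because the assigning is also induced over
    [A * Z_n] for every [n > 1] ([assigning_polyE]). *)

(** * Counting equivalence classes *)

Lemma eq_in_equivalence_partition (T : finType) (r1 r2 : rel T) (D : {set T}) :
  {in D &, r1 =2 r2} ->
  equivalence_partition r1 D = equivalence_partition r2 D.
Proof.
move=> r12; apply: eq_in_imset => x xD.
by apply/setP=> y; rewrite !inE; case yD: (y \in D) => //=; apply: r12.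
Qed.

(** Deleting points merges or kills no class as long as every class keeps a
    point: [K |-> K :\: X] is then a bijection on classes.  Both component
    counts below (deleting a bridge, deleting one side of a bond) come from
    this. *)
Lemma card_equivalence_partition_setC (T : finType) (r : rel T) (X : {set T}) :
  equivalence_rel r -> (forall x, exists2 y, y \notin X & r x y) ->
  #|equivalence_partition r (~: X)| = #|equivalence_partition r setT|.
Proof.
move=> r_eq meets.
have /equivalence_relP [_ rtrans] := r_eq.
have -> : equivalence_partition r (~: X) =
          (fun K => K :\: X) @: equivalence_partition r setT.
  apply/setP=> K; apply/imsetP/imsetP => [[x _ ->]|[_ /imsetP[x _ ->] ->]].
    exists [set y in setT | r x y]; first by apply: imset_f.
    by apply/setP=> y; rewrite !inE.
  have [y yX rxy] := meets x.
  exists y; rewrite ?inE //; apply/setP=> z; rewrite !inE.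
  by rewrite (rtrans _ _ rxy).
apply: card_in_imset => _ _ /imsetP[x _ ->] /imsetP[x' _ ->] /setP eqK.
have [y yX rxy] := meets x.
have := eqK y; rewrite !inE yX rxy /= => /esym rx'y.
apply/setP=> z; rewrite !inE /=.
by rewrite (rtrans _ _ rxy) (rtrans _ _ rx'y).
Qed.

HB.instance Definition _ (A B : finZmodType) := GRing.Zmodule.on (A * B)%type.

Section SpanningSubgraphs.

Variable G : mgraph.
Local Notation V := (vertex G).
Local Notation E := (edge G).

Implicit Types (T U C : {set E}) (W X : {set V}) (e : E).

(** * Connectivity of spanning subgraphs *)

Definition step T : rel V := fun u v =>
  [exists e in T, ((ehead e == u) && (etail e == v)) ||
                  ((ehead e == v) && (etail e == u))].

Definition conn T : rel V := connect (step T).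

(** Unions of components of [(V, T)], described without mentioning paths; this
    dual description is what makes the zero-sum conditions easy to compare for
    different edge sets. *)
Definition uncut T W := [forall e in T, (ehead e \in W) == (etail e \in W)].

Definition component T v : {set V} := [set u | conn T v u].

Definition ncomp T := #|equivalence_partition (conn T) setT|.

Lemma uncutP T W :
  reflect (forall e, e \in T -> (ehead e \in W) = (etail e \in W)) (uncut T W).
Proof.
apply: (iffP forall_inP) => h e eT; first by apply/eqP; apply: h.
by apply/eqP; apply: h.
Qed.

Lemma uncutS T U W : T \subset U -> uncut U W -> uncut T W.
Proof. by move=> /subsetP TU /uncutP h; apply/uncutP=> e /TU; apply: h. Qed.

Lemma uncutC T W : uncut T (~: W) = uncut T W.
Proof.
apply: eq_forallb => e; rewrite !inE; case: (e \in T) => //=.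
by case: (ehead e \in W); case: (etail e \in W).
Qed.

Lemma uncutD T W X : uncut T W -> uncut T X -> uncut T (W :\: X).
Proof.
by move=> /uncutP hW /uncutP hX; apply/uncutP=> e eT; rewrite !inE hW // hX.
Qed.

Lemma uncutU1 T W e :
  uncut (e |: T) W = ((ehead e \in W) == (etail e \in W)) && uncut T W.
Proof.
apply/uncutP/andP => [h|[/eqP he /uncutP h] e'].
  split; first by apply/eqP/h/setU11.
  by apply/uncutP=> e' e'T; apply/h/setU1r.
by case/setU1P=> [->|/h].
Qed.

Lemma step_sym T : symmetric (step T).
Proof. by move=> u v; apply: eq_existsb => e; rewrite orbC. Qed.

Lemma conn_refl T v : conn T v v.
Proof. exact: connect0. Qed.

Lemma conn_sym T : symmetric (conn T).
Proof. exact: sym_connect_sym (@step_sym T). Qed.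

Lemma conn_eql T u v : conn T u v -> conn T u =1 conn T v.
Proof. exact: same_connect (conn_sym T) _ _. Qed.

Lemma conn_eqr T u v : conn T u v -> conn T ^~ u =1 conn T ^~ v.
Proof. exact: same_connect_r (conn_sym T) _ _. Qed.

Lemma conn_equiv T : equivalence_rel (conn T).
Proof.
move=> x y z; split; first exact: connect0.
by move=> xy; apply: conn_eql.
Qed.

Lemma conn_edge T e : e \in T -> conn T (ehead e) (etail e).
Proof.
by move=> eT; apply: connect1; apply/existsP; exists e; rewrite eT !eqxx.
Qed.

Lemma uncut_conn T W u v : uncut T W -> conn T u v -> (u \in W) = (v \in W).
Proof.
move=> /uncutP h; apply: closed_connect => {}u {}v /existsP[e] /andP[eT].
by case/orP=> /andP[/eqP <- /eqP <-]; rewrite h.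
Qed.

Lemma component_id T v : v \in component T v.
Proof. by rewrite inE; apply: connect0. Qed.

Lemma uncut_component T v : uncut T (component T v).
Proof.
apply/uncutP=> e eT; rewrite !inE.
exact: conn_eqr (conn_edge eT) v.
Qed.

Lemma sub_uncut_conn T U :
  (forall W, uncut U W -> uncut T W) -> subrel (conn T) (conn U).
Proof.
move=> TU u v uv; have := component_id U u.
by rewrite (uncut_conn (TU _ (uncut_component U u)) uv) inE.
Qed.

Lemma connS T U : T \subset U -> subrel (conn T) (conn U).
Proof. by move=> TU; apply: sub_uncut_conn => W; apply: uncutS. Qed.

Lemma uncut_add_conn T e W :
  conn T (ehead e) (etail e) -> uncut (e |: T) W = uncut T W.
Proof.
move=> he; rewrite uncutU1 andb_idl // => /uncut_conn h.
by rewrite (h _ _ he).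
Qed.

Lemma conn_add_conn T e :
  conn T (ehead e) (etail e) -> conn (e |: T) =2 conn T.
Proof.
move=> he u v; apply/idP/idP; apply: sub_uncut_conn => W.
  by rewrite uncut_add_conn.
by rewrite uncut_add_conn.
Qed.

(** A new edge joins nothing but the components of its two ends, so away from
    one of these components connectivity is the same as before. *)
Lemma conn_add_outside T e u v :
  ~~ conn T (ehead e) (etail e) ->
  u \notin component T (ehead e) -> v \notin component T (ehead e) ->
  conn (e |: T) u v = conn T u v.
Proof.
move=> he uX vX; apply/idP/idP; last exact: connS (subsetUr _ _) _ _.
move=> uv; set X := component T (ehead e) in uX vX.
(* [Y] is the component of [u] once [e] is added, and [v] lies in it. *)
pose Y := if etail e \in component T u then component T u :|: X
          else component T u.
have hX : ehead e \in X by apply: component_id.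
have hu : ehead e \notin component T u by rewrite inE conn_sym; rewrite inE in uX.
have uncutY : uncut (e |: T) Y.
  rewrite uncutU1 /Y; case: ifP => tu.
    rewrite !in_setU tu hX orbT eqxx /= -uncutC setCU.
    by rewrite -setDE uncutD ?uncutC ?uncut_component.
  by rewrite tu (negPf hu) uncut_component.
have uY : u \in Y by rewrite /Y; case: ifP; rewrite ?in_setU component_id.
move: uY; rewrite (uncut_conn uncutY uv) /Y; case: ifP => _.
  by rewrite inE (negPf vX) orbF inE.
by rewrite inE.
Qed.

Lemma ncomp0 : ncomp set0 = #|V|.
Proof.
rewrite /ncomp -cardsT card_in_imset // => x y _ _ /setP /(_ y).
rewrite !inE /= conn_refl => xy.
have ux : uncut set0 [set x] by apply/uncutP=> e; rewrite in_set0.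
by have := uncut_conn ux xy; rewrite !inE eqxx => /esym /eqP.
Qed.

Lemma ncomp_add_conn T e :
  conn T (ehead e) (etail e) -> ncomp (e |: T) = ncomp T.
Proof.
move=> he; rewrite /ncomp (@eq_in_equivalence_partition _ _ (conn T)) //.
by move=> u v _ _; apply: conn_add_conn.
Qed.

(** No component of [T] with the bridge [e] added lies within the [ehead e]-side
    of [e]: the component that contains that side also contains [etail e]. *)
Lemma bridge_exit T e x : ~~ conn T (ehead e) (etail e) ->
  exists2 y, y \notin component T (ehead e) & conn (e |: T) x y.
Proof.
move=> he; case: (boolP (x \in component T (ehead e))) => xX; last first.
  by exists x => //; apply: conn_refl.
exists (etail e); first by rewrite inE.
apply: connect_trans (conn_edge (setU11 _ _)).
by apply: (connS (subsetUr _ _)); rewrite conn_sym; rewrite inE in xX.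
Qed.

Lemma ncomp_add_bridge T e :
  ~~ conn T (ehead e) (etail e) -> ncomp T = (ncomp (e |: T)).+1.
Proof.
move=> he; pose X := component T (ehead e).
have meets x := bridge_exit x he.
rewrite /ncomp -(card_equivalence_partition_setC (conn_equiv (e |: T)) meets).
rewrite (@eq_in_equivalence_partition _ (conn (e |: T)) (conn T)); last first.
  by move=> u v; rewrite !inE => uX vX; apply: conn_add_outside; rewrite ?inE.
(* The classes of [conn T] are [X] and those of its complement. *)
have -> : equivalence_partition (conn T) setT =
          X |: equivalence_partition (conn T) (~: X).
  apply/setP=> K; apply/imsetP/setU1P => [[x _ ->]|[->|/imsetP[x xX ->]]].
  - case: (boolP (x \in X)) => xX.
      left; apply/setP=> y; rewrite !inE in xX *.
      by rewrite (conn_eql xX).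
    right; apply/imsetP; exists x; first by rewrite inE.
    apply/setP=> y; rewrite !inE /=; case: (boolP (conn T x y)) => xy.
      rewrite andbT inE in xX *.
      by rewrite -(conn_eqr xy).
    by rewrite andbF.
  - by exists (ehead e) => //; apply/setP=> y; rewrite !inE.
  - exists x => //; apply/setP=> y; rewrite !inE /=.
    case: (boolP (conn T x y)) => xy; last by rewrite andbF.
    rewrite !inE in xX *.
    by rewrite -(conn_eqr xy) xX.
rewrite cardsU1 [_ \notin _](_ : _ = true) //.
apply/imsetP=> -[x _ /setP /(_ (ehead e))].
by rewrite component_id !inE conn_refl.
Qed.

(** Deletion and contraction act on pairs [C \subset U] (contract [C], delete
    the complement of [U]): an element of [U :\: C] is either put into [C] or
    removed from [U]. *)
Lemma edge_interval_ind (P : {set E} -> {set E} -> Prop) :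
  (forall U, P U U) ->
  (forall C U e, e \notin U -> C \subset U ->
     P (e |: C) (e |: U) -> P C U -> P C (e |: U)) ->
  forall C U, C \subset U -> P C U.
Proof.
move=> P0 Pstep C U; move En: #|U :\: C| => n.
elim: n C U En => [|n IH] C U En CU.
  have/eqP := En; rewrite cards_eq0 setD_eq0 => UC.
  by have -> : U = C by apply/eqP; rewrite eqEsubset UC CU.
have [e] : exists e, e \in U :\: C by apply/set0Pn; rewrite -card_gt0 En.
move=> eUC; have := eUC; rewrite inE => /andP[eC eU].
have card_D1 : #|(U :\: C) :\ e| = n by move: En; rewrite (cardsD1 e) eUC => -[].
have CUe : C \subset U :\ e by rewrite subsetD1 CU.
rewrite -(setD1K eU); apply: Pstep; rewrite ?setD11 ?setD1K //; apply: IH => //.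
- by rewrite -card_D1; apply: eq_card => x; rewrite !inE negb_or -andbA.
- by rewrite subUset sub1set eU.
- by rewrite -card_D1; apply: eq_card => x; rewrite !inE andbCA.
Qed.

Lemma edge_add_ind (P : {set E} -> Prop) T :
  P T -> (forall U e, e \notin U -> P U -> P (e |: U)) ->
  forall U, T \subset U -> P U.
Proof.
move=> PT Padd U TU; move: PT; pattern T, U.
by apply: edge_interval_ind TU => // C {}U e eU _ _ IH /IH; apply: Padd.
Qed.

(** The cycle rank of [(V, T)]. *)
Definition nullity T := (#|T| + ncomp T - #|V|)%N.

Lemma card_ncomp_mono T U :
  T \subset U -> (#|T| + ncomp T <= #|U| + ncomp U)%N.
Proof.
move: U; apply: edge_add_ind => // U e eU; rewrite cardsU1 eU => IH.
case: (boolP (conn U (ehead e) (etail e))) => he.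
  by rewrite ncomp_add_conn //; lia.
by rewrite (ncomp_add_bridge he) in IH; lia.
Qed.

Lemma leq_card_ncomp T : (#|V| <= #|T| + ncomp T)%N.
Proof. by have := card_ncomp_mono (sub0set T); rewrite cards0 ncomp0. Qed.

Lemma nullityK T : (nullity T + #|V| = #|T| + ncomp T)%N.
Proof. by rewrite /nullity subnK // leq_card_ncomp. Qed.

Lemma nullity_mono T U : T \subset U -> (nullity T <= nullity U)%N.
Proof. by move=> /card_ncomp_mono TU; rewrite leq_sub2r. Qed.

Lemma nullity0 : nullity set0 = 0%N.
Proof. by rewrite /nullity cards0 ncomp0 add0n subnn. Qed.

Lemma nullity_add_conn T e : e \notin T ->
  conn T (ehead e) (etail e) -> nullity (e |: T) = (nullity T).+1.
Proof.
move=> eT he; have := nullityK T; have := nullityK (e |: T).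
by rewrite ncomp_add_conn // cardsU1 eT; lia.
Qed.

Lemma nullity_add_bridge T e : e \notin T ->
  ~~ conn T (ehead e) (etail e) -> nullity (e |: T) = nullity T.
Proof.
move=> eT he; have := nullityK T; have := nullityK (e |: T).
by rewrite (ncomp_add_bridge he) cardsU1 eT; lia.
Qed.

(** * Zero-sum conditions *)

Lemma step_setT : adj_in setT =2 step setT.
Proof.
by move=> u v; rewrite /adj_in !in_setT; apply: eq_existsb => e; rewrite in_setT.
Qed.

Lemma components_setT : components_in setT = equivalence_partition (conn setT) setT.
Proof.
by apply: eq_in_equivalence_partition => u v _ _; apply: eq_connect step_setT _ _.
Qed.

Lemma cyclomaticE : cyclomatic G = nullity setT.
Proof. by rewrite /cyclomatic /ncomp_in components_setT /nullity cardsT. Qed.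

(** Every component of [(V, T)] has zero sum; quantifying over all unions of
    components makes this visibly monotone in [T]. *)
Definition balanced (A : zmodType) T (b : {ffun V -> A}) :=
  [forall W : {set V}, uncut T W ==> (\sum_(v in W) b v == 0)].

Section Balanced.

Variable A : zmodType.
Implicit Types b : {ffun V -> A}.

Lemma balancedP T b :
  reflect (forall W, uncut T W -> \sum_(v in W) b v = 0) (balanced T b).
Proof.
apply: (iffP forall_inP) => h W /h; first exact: eqP.
by move=> ->.
Qed.

Lemma balancedS T U b : T \subset U -> balanced T b -> balanced U b.
Proof. by move=> TU /balancedP h; apply/balancedP=> W /(uncutS TU); apply: h. Qed.

Lemma balanced_add_conn T e b :
  conn T (ehead e) (etail e) -> balanced (e |: T) b = balanced T b.
Proof. by move=> he; apply: eq_forallb => W; rewrite uncut_add_conn. Qed.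

(** Two unions of [T]-components that both separate [e] in the same direction
    differ by unions of components of [T] with [e] added. *)
Lemma eq_sum_separating T e b W X :
  balanced (e |: T) b -> uncut T W -> uncut T X ->
  ehead e \in W :&: X -> etail e \notin W :|: X ->
  \sum_(v in W) b v = \sum_(v in X) b v.
Proof.
move=> /balancedP bal uW uX; rewrite !inE negb_or => /andP[hW hX] /andP[tW tX].
rewrite (big_setID X) [RHS](big_setID W) /= (setIC X).
have sumD Y Z : uncut T Y -> uncut T Z -> ehead e \in Z -> etail e \notin Y ->
    \sum_(v in Y :\: Z) b v = 0.
  move=> uY uZ hZ tY; apply: bal.
  by rewrite uncutU1 !inE hZ (negPf tY) andbF eqxx uncutD.
by rewrite !sumD.
Qed.

Lemma balanced_add_separating T e b X :
  uncut T X -> ehead e \in X -> etail e \notin X -> balanced (e |: T) b ->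
  \sum_(v in X) b v = 0 -> balanced T b.
Proof.
move=> uX hX tX bal X0; apply/balancedP=> W uW.
have /balancedP balW := bal.
case: (boolP (ehead e \in W)) => hW; case: (boolP (etail e \in W)) => tW.
- by apply: balW; rewrite uncutU1 hW tW eqxx.
- apply: etrans X0; apply: (eq_sum_separating bal uW uX).
    by rewrite inE hW.
  by rewrite inE negb_or tW.
(* Here [W] separates [e] the other way round; its complement does not. *)
- have : \sum_(v in ~: W) b v = \sum_(v in X) b v.
    by apply: (eq_sum_separating bal _ uX); rewrite ?uncutC // !inE ?negb_or ?hW ?tW.
  have : \sum_(v in [set: V]) b v = 0.
    by apply: balW; rewrite /uncut; apply/forall_inP=> e' _; rewrite !inE.
  by rewrite (big_setID W) setTI setTD /= => + Wc; rewrite Wc X0 addr0.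
- by apply: balW; rewrite uncutU1 (negPf hW) (negPf tW) eqxx.
Qed.

End Balanced.

Lemma balanced_setT (A : finZmodType) (b : {ffun V -> A}) :
  locally_zero_sum b -> balanced setT b.
Proof.
move=> /forall_inP lzs; apply/balancedP=> W uW.
have part : partition (equivalence_partition (conn setT) setT) setT.
  by apply: equivalence_partitionP => x y z _ _ _; apply: conn_equiv.
have -> : \sum_(v in W) b v = \sum_(v in [set: V]) (if v \in W then b v else 0).
  by rewrite -big_mkcondr; apply: eq_bigl => v; rewrite inE.
rewrite (set_partition_big _ part) /= big1 // => C; rewrite -components_setT => CC.
have /eqP C0 := lzs C CC; move: CC; rewrite components_setT => /imsetP[x _ defC].
case: (boolP (x \in W)) => xW.
  rewrite -[RHS]C0; apply: eq_bigr => v; rewrite defC !inE /= => xv.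
  by rewrite -(uncut_conn uW xv) xW.
apply: big1 => v; rewrite defC !inE /= => xv.
by rewrite -(uncut_conn uW xv) (negPf xW).
Qed.

(** * Counting flows *)

Section Flows.

Variable A : finZmodType.
Implicit Types (b : {ffun V -> A}) (f : {ffun E -> A}) (a : A).

Definition flows_in T b : {set {ffun E -> A}} :=
  [set f | (boundary f == b) && [forall e, (e \notin T) ==> (f e == 0)]].

Definition edge_flow e a : {ffun E -> A} := [ffun x => if x == e then a else 0].

Lemma boundaryD f1 f2 : boundary (f1 + f2) = boundary f1 + boundary f2.
Proof.
apply/ffunP=> v; rewrite !ffunE.
under eq_bigr do rewrite ffunE; rewrite big_split /=.
under [X in _ - X]eq_bigr do rewrite ffunE; rewrite [X in _ - X]big_split /=.
by rewrite opprD addrACA.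
Qed.

Lemma sum_boundary_edge_flow e a W :
  \sum_(v in W) boundary (edge_flow e a) v =
  (if ehead e \in W then a else 0) - (if etail e \in W then a else 0).
Proof.
have single (end_of : E -> V) :
  \sum_(v in W) \sum_(x | end_of x == v) edge_flow e a x =
  if end_of e \in W then a else 0.
  rewrite (exchange_big_dep predT) //= (bigD1 e) //= [X in _ + X]big1 => [|x xe].
    rewrite addr0 ffunE eqxx; case: ifP => eW.
      rewrite (big_pred1 (end_of e)) // => v; rewrite /= andbC eq_sym.
      by case: eqP => // ->.
    by rewrite big_pred0 // => v; apply/andP=> -[vW /eqP ev]; rewrite ev vW in eW.
  by apply: big1 => v _; rewrite ffunE (negPf xe).
under eq_bigr do rewrite ffunE.
by rewrite big_split /= sumrN !single.
Qed.

Lemma sum_sub_boundary b e a W :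
  \sum_(v in W) (b - boundary (edge_flow e a)) v =
  \sum_(v in W) b v -
    ((if ehead e \in W then a else 0) - (if etail e \in W then a else 0)).
Proof.
rewrite -sum_boundary_edge_flow -sumrB.
by apply: eq_bigr => v _; rewrite !ffunE.
Qed.

Lemma balanced_sub_boundary T e a b :
  conn T (ehead e) (etail e) ->
  balanced T (b - boundary (edge_flow e a)) = balanced T b.
Proof.
move=> he; apply: eq_forallb_in => W uW.
by rewrite sum_sub_boundary (uncut_conn uW he) subrr subr0.
Qed.

Lemma card_flows_in_add T e b : e \notin T ->
  #|flows_in (e |: T) b| =
  (\sum_a #|flows_in T (b - boundary (edge_flow e a))%R|)%N.
Proof.
move=> eT; rewrite -sum1_card (partition_big (fun f : {ffun E -> A} => f e) predT) //=.
apply: eq_bigr => a _.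
rewrite -(card_imset _ (addIr (edge_flow e a))) -sum1_card; apply: eq_bigl => f.
apply/andP/imsetP => [[]|[g]].
  rewrite inE => /andP[/eqP bf /forall_inP f0] /eqP fe.
  exists (f - edge_flow e a); last by rewrite subrK.
  rewrite inE; apply/andP; split.
    by rewrite eq_sym subr_eq -boundaryD subrK bf.
  apply/forall_inP=> x xT; rewrite !ffunE; case: (x =P e) => [->|/eqP xe].
    by rewrite fe subrr.
  by rewrite subr0 f0 // !inE negb_or xe.
rewrite inE => /andP[/eqP bg /forall_inP g0] ->; split; last first.
  by rewrite !ffunE eqxx (eqP (g0 _ eT)) add0r.
rewrite inE boundaryD bg subrK eqxx; apply/forall_inP=> x.
rewrite !inE negb_or => /andP[xe xT].
by rewrite !ffunE (negPf xe) addr0 g0.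
Qed.

(** The flows supported on [T] form, when there are any, a coset of the cycle
    group of [(V, T)].  Adding an edge inside a component frees one value of
    the flow; adding a bridge forces its value to be the sum of [b] over the
    side of its head. *)
Lemma card_flows_in T b :
  #|flows_in T b| = if balanced T b then (#|A| ^ nullity T)%N else 0%N.
Proof.
move: T (sub0set T) b; apply: edge_add_ind => [b|T e eT IH b].
  rewrite nullity0 expn0.
  have uncut0 W : uncut set0 W by apply/uncutP=> e; rewrite in_set0.
  have bnd0 : boundary (0 : {ffun E -> A}) = 0.
    by apply/ffunP=> v; rewrite !ffunE !big1 ?subrr // => e _; rewrite ffunE.
  have bal0 : balanced set0 b = (b == 0).
    apply/balancedP/eqP => [h|-> W _]; last by apply: big1 => v _; rewrite ffunE.
    by apply/ffunP=> v; rewrite ffunE -(h [set v] (uncut0 _)) big_set1.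
  have flow0 f : (f \in flows_in set0 b) = (f == 0) && (b == 0).
    rewrite inE; apply/andP/andP => [[/eqP bf /forall_inP f0]|[/eqP -> /eqP ->]].
      have f00 : f = 0 by apply/ffunP=> e; rewrite ffunE; apply/eqP/f0; rewrite in_set0.
      by rewrite -bf f00 bnd0 !eqxx.
    by rewrite bnd0 eqxx; split=> //; apply/forall_inP=> e _; rewrite ffunE.
  rewrite bal0; case: eqP flow0 => b0 flow0.
    by apply: eq_card1 (0 : {ffun E -> A}) _ _ => f; rewrite flow0 andbT.
  by apply: eq_card0 => f; rewrite flow0 andbF.
rewrite card_flows_in_add //; under eq_bigr do rewrite IH.
case: (boolP (conn T (ehead e) (etail e))) => he.
  under eq_bigr do rewrite balanced_sub_boundary //.
  rewrite balanced_add_conn // nullity_add_conn // sum_nat_const.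
  by case: ifP => _; rewrite ?muln0 // expnS.
rewrite nullity_add_bridge //.
have eU : conn (e |: T) (ehead e) (etail e) by apply/conn_edge/setU11.
case: ifP => bal; last first.
  apply: big1 => a _; case: ifP => // /(balancedS (subsetUr [set e] T)).
  by rewrite balanced_sub_boundary // bal.
set X := component T (ehead e).
have uX : uncut T X by apply: uncut_component.
have hX : ehead e \in X by apply: component_id.
have tX : etail e \notin X by rewrite inE.
rewrite (bigD1 (\sum_(v in X) b v)) //= [Y in (_ + Y)%N]big1 => [|a aX].
  rewrite addn0 (balanced_add_separating uX hX tX) ?balanced_sub_boundary //.
  by rewrite sum_sub_boundary hX (negPf tX) subr0 subrr.
case: ifP => // /balancedP /(_ X uX).
by rewrite sum_sub_boundary hX (negPf tX) subr0 => /eqP; rewrite subr_eq0 eq_sym (negPf aX).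
Qed.

(** * The assigning polynomial by inclusion-exclusion *)

(** The alternating sum is the expansion of the product over [e] of
    [1 - (e \notin S)]. *)
Lemma sum_sign_supersets (S : {set E}) :
  \sum_(T : {set E} | S \subset T) (-1) ^+ #|~: T| = (S == setT)%:R :> rat.
Proof.
transitivity (\sum_(T : {set E}) \prod_e (if e \in T then 1 else - (e \notin S)%:R) : rat).
  rewrite big_mkcond; apply: eq_bigr => T _.
  rewrite (bigID (mem T)) /= big1 => [|e ->] //; rewrite mul1r.
  rewrite (eq_bigr (fun e => - (e \notin S)%:R)) => [|e /negPf -> //].
  case: ifP => [/subsetP ST|/negbT /subsetPn[e eS eT]].
    rewrite (eq_bigr (fun=> -1)) => [|e eT].
      rewrite prodr_const; congr (_ ^+ _); apply: eq_card => e.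
      by rewrite [in LHS]inE.
    by rewrite (contra (ST e) eT).
  by rewrite (bigD1 e) //= eS oppr0 mul0r.
transitivity (\prod_e (1 - (e \notin S)%:R) : rat); first by rewrite bigA_distr.
case: eqP => [->|ne].
  by apply: big1 => e _; rewrite in_setT subr0.
have [e eS] : exists e, e \notin S.
  by apply/existsP; rewrite -negb_forall; apply: contra_notN ne => /forallP h; apply/setP=> e; rewrite h inE.
by rewrite (bigD1 e) //= eS subrr mul0r.
Qed.

Definition flow_poly b : {poly rat} :=
  \sum_(T | balanced T b) (-1) ^+ #|~: T| *: 'X^(nullity T).

Lemma size_flow_poly b : (size (flow_poly b) <= (cyclomatic G).+1)%N.
Proof.
apply: leq_trans (size_sum _ _ _) _; apply/bigmax_leqP => T _.
apply: leq_trans (size_scale_leq _ _) _.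
by rewrite size_polyXn cyclomaticE ltnS nullity_mono ?subsetT.
Qed.

Lemma flow_polyE b : (flow_poly b).[#|A|%:R] = (num_nz_flows b)%:R.
Proof.
rewrite horner_sum big_mkcond /=.
transitivity (\sum_(T : {set E}) \sum_(f in flows_in T b) (-1) ^+ #|~: T| : rat).
  apply: eq_bigr => T _; rewrite sumr_const card_flows_in.
  by case: ifP => // _; rewrite hornerZ hornerXn -natrX mulr_natr.
pose supp (f : {ffun E -> A}) := [set e | f e != 0].
have in_flows T f : (f \in flows_in T b) = (boundary f == b) && (supp f \subset T).
  rewrite inE; congr (_ && _); apply/forall_inP/subsetP => h e.
    by rewrite inE; apply: contraNT => /h.
  by apply: contraNT => fe; apply: h; rewrite inE.
rewrite (exchange_big_dep (fun f => boundary f == b)) /=; last first.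
  by move=> T f _; rewrite in_flows => /andP[].
rewrite (eq_bigr (fun f => (supp f == setT)%:R)) => [|f bf].
  rewrite -natr_sum /num_nz_flows -sum1dep_card; congr _%:R.
  rewrite -big_mkcondr /=; apply: eq_bigl => f; congr (_ && _).
  apply/eqP/forallP => [/setP h e|h]; first by have := h e; rewrite !inE.
  by apply/setP=> e; rewrite !inE h.
rewrite -sum_sign_supersets; apply: eq_bigl => T.
by rewrite in_flows bf.
Qed.

Lemma coef_flow_poly b j :
  (flow_poly b)`_j = \sum_(T | balanced T b && (nullity T == j)) (-1) ^+ #|~: T|.
Proof.
rewrite coef_sum big_mkcondr; apply: eq_bigr => T _.
by rewrite coefZ coefXn eq_sym; case: eqP; rewrite ?mulr1 ?mulr0.
Qed.

End Flows.

(** * Bonds *)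

(** A path of [(V, U)] cannot leave a union of components, so it is a path of
    the subgraph of [G] induced on that union. *)
Lemma conn_within U W u v :
  uncut U W -> u \in W -> conn U u v -> connect (adj_in W) u v.
Proof.
move=> /uncutP uW uinW uv; pose Z := [set w | connect (adj_in W) u w].
have inW w : w \in Z -> w \in W.
  rewrite inE => /(closed_connect _) <- // x y /and3P[xW yW _].
  by rewrite xW yW.
have stepZ x y : x \in W -> y \in W -> x \in Z ->
    [exists e, ((ehead e == x) && (etail e == y)) ||
               ((ehead e == y) && (etail e == x))] -> y \in Z.
  move=> xW yW; rewrite !inE => ux xy.
  by apply: connect_trans ux (connect1 _); apply/and3P.
have uZ : uncut U Z.
  apply/uncutP=> e eU; apply/idP/idP => eZ; have eW := inW _ eZ.
    apply: (stepZ _ _ eW _ eZ); first by rewrite -uW.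
    by apply/existsP; exists e; rewrite !eqxx.
  apply: (stepZ _ _ eW _ eZ); first by rewrite uW.
  by apply/existsP; exists e; rewrite !eqxx orbT.
have : u \in Z by rewrite inE.
by rewrite (uncut_conn uZ uv) inE.
Qed.

(** [(V, U)] has the same components as [G]. *)
Definition spanning U := [forall e, conn U (ehead e) (etail e)].

Lemma conn_spanning U : spanning U -> conn setT =2 conn U.
Proof.
move=> /forallP sU u v; apply/idP/idP; last exact: connS (subsetT U) _ _.
apply: sub_uncut_conn => W uW; apply/uncutP=> e _; exact: uncut_conn uW (sU e).
Qed.

Lemma balanced_spanning (A : zmodType) U (b : {ffun V -> A}) :
  spanning U -> balanced setT b -> balanced U b.
Proof.
move=> /forallP sU /balancedP bal; apply/balancedP => W uW; apply: bal.
by apply/uncutP=> e _; apply: uncut_conn uW (sU e).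
Qed.

(** Removing a bridge from a spanning subgraph with as many components as [G]
    splits one component of [G] into two connected sides; each side is
    connected in [G] and leaves exactly one component behind, the other side. *)
Lemma bridge_side_in_Lambda U e :
  spanning (e |: U) -> ~~ conn U (ehead e) (etail e) ->
  component U (ehead e) \in Lambda G.
Proof.
move=> sU he; set X := component U (ehead e).
have uX : uncut U X by apply: uncut_component.
rewrite inE; apply/and3P; split.
- by apply/set0Pn; exists (ehead e); apply: component_id.
- apply/forall_inP => u uX'; apply/forall_inP => v vX.
  apply: (conn_within uX) => //; rewrite !inE in uX' vX.
  by rewrite -(conn_eql uX').
- rewrite /ncomp_in components_setT.
  rewrite -(@card_equivalence_partition_setC _ _ X (conn_equiv _)) => [|x]; last first.
    have [y yX xy] := bridge_exit x he.
    by exists y => //; rewrite (conn_spanning sU).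
  apply/eqP; congr #|pred_of_set _|.
  apply: eq_in_equivalence_partition => u v; rewrite !in_setC => u_X v_X.
  apply/idP/idP; last first.
    rewrite (conn_spanning sU) conn_add_outside //.
    by apply: conn_within; rewrite ?uncutC ?in_setC.
  apply: connect_sub => x y /and3P[_ _ xy]; apply: connect1.
  by case/existsP: xy => e' xy; apply/existsP; exists e'; rewrite in_setT.
Qed.

(** * Monotonicity by deletion and contraction *)

(** Up to sign, the coefficient of degree [j] in the inclusion-exclusion sum of
    the minor obtained from [(V, U)] by contracting [C].  The factor [(-1) ^+ ncomp U] turns coefficients into
    signless coefficients. *)
Definition minor_coef (A : zmodType) (b : {ffun V -> A}) (j : nat) C U : rat :=
  (-1) ^+ ncomp U *
  \sum_(T : {set E} | [&& C \subset T, T \subset U, balanced T b & nullity T == j])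
    (-1) ^+ ncomp T.

Section MinorCoef.

Variables (A : zmodType) (b : {ffun V -> A}) (j : nat).

Lemma minor_coef_refl U :
  minor_coef b j U U = (balanced U b && (nullity U == j))%:R.
Proof.
rewrite /minor_coef; case: (boolP (_ && _)) => cond; last first.
  rewrite big_pred0 ?mulr0 // => T; apply: contraNF cond.
  by case/and4P=> UT TU; have -> : T = U by [apply/eqP; rewrite eqEsubset TU UT]; move=> -> ->.
rewrite (big_pred1 U) => [|T]; first by rewrite -exprD addnn -signr_odd odd_double.
apply/and4P/eqP => [[UT TU _ _]|->]; first by apply/eqP; rewrite eqEsubset TU UT.
by case/andP: cond => -> ->.
Qed.

Lemma minor_sum_split C U e : e \notin U -> C \subset U ->
  \sum_(T : {set E} | [&& C \subset T, T \subset e |: U, balanced T b & nullity T == j])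
     (-1) ^+ ncomp T =
  \sum_(T : {set E} | [&& e |: C \subset T, T \subset e |: U, balanced T b & nullity T == j])
     (-1) ^+ ncomp T +
  \sum_(T : {set E} | [&& C \subset T, T \subset U, balanced T b & nullity T == j])
     (-1) ^+ ncomp T :> rat.
Proof.
move=> eU CU; rewrite (bigID (fun T : {set E} => e \in T)) /=.
congr (_ + _); apply: eq_bigl => T.
  by rewrite subUset sub1set andbC !andbA.
have -> : (T \subset U) = (T \subset e |: U) && (e \notin T).
  by rewrite -(subsetD1 T (e |: U) e) setU1K.
by case: (C \subset T); case: (T \subset _); case: (e \in T); rewrite ?andbT ?andbF.
Qed.

Lemma minor_coef_add_conn C U e : e \notin U -> C \subset U ->
  conn U (ehead e) (etail e) ->
  minor_coef b j C (e |: U) =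
  minor_coef b j (e |: C) (e |: U) + minor_coef b j C U.
Proof.
by move=> eU CU he; rewrite /minor_coef minor_sum_split // mulrDr ncomp_add_conn.
Qed.

Lemma minor_coef_bridge_unbalanced C U e : e \notin U -> C \subset U ->
  ~~ balanced U b ->
  minor_coef b j C (e |: U) = minor_coef b j (e |: C) (e |: U).
Proof.
move=> eU CU unbal; rewrite /minor_coef minor_sum_split //.
rewrite [X in _ + X]big_pred0 ?addr0 // => T; apply: contraNF unbal.
by case/and4P=> _ TU + _; apply: balancedS.
Qed.

(** When both sides of the bridge have zero sum, its flow value vanishes, so it
    may be added or removed freely and the terms cancel in pairs. *)
Lemma minor_coef_bridge_balanced C U e : e \notin U -> C \subset U ->
  ~~ conn U (ehead e) (etail e) -> balanced U b ->
  minor_coef b j C (e |: U) = 0.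
Proof.
move=> eU CU he bal; rewrite /minor_coef minor_sum_split //.
(* Pair the terms with and without [e]. *)
rewrite (reindex_onto (fun T : {set E} => e |: T) (fun T => T :\ e)) /=; last first.
  by move=> T /and4P[]; rewrite subUset sub1set => /andP[eT _] _ _ _; rewrite setD1K.
set S := (X in _ + X).
rewrite [X in X + _](_ : _ = - S) ?addNr ?mulr0 //.
have eT (T : {set E}) : T \subset U -> e \notin T.
  by move=> /subsetP TU; apply: contra eU; apply: TU.
rewrite /S -sumrN; apply: eq_big => [T|T /andP[/and4P[_ TU _ _] /eqP TeT]]; last first.
  have {}eT : e \notin T by rewrite -TeT setD11.
  have heT : ~~ conn T (ehead e) (etail e).
    apply: contra he; apply: connS; rewrite -(setU1K eU) subsetD1 eT andbT.
    exact: subset_trans (subsetUr _ _) TU.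
  by rewrite (ncomp_add_bridge heT) exprS mulN1r opprK.
case: (boolP (T \subset U)) => TU; last first.
  rewrite andbF; apply/negP => /andP[/and4P[_ eTU _ _] /eqP TeT].
  case/negP: TU; rewrite -(setU1K eU) -TeT; exact: setSD.
have heT : ~~ conn T (ehead e) (etail e) by apply: contra he; apply: connS.
rewrite nullity_add_bridge ?eT // setU1K ?eT // eqxx andbT (setUS _ TU).
have -> : (e |: C \subset e |: T) = (C \subset T).
  apply/idP/idP; last exact: setUS.
  by move=> /(setSD [set e]); rewrite !setU1K ?eT.
congr [&& _, _ & _]; congr (_ && _).
apply/idP/idP => [balT|]; last by apply: balancedS (subsetUr _ _).
have uX := uncut_component U (ehead e).
apply: (balanced_add_separating (uncutS TU uX) _ _ balT).
- exact: component_id.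
- by rewrite inE.
- by move/balancedP: bal; apply.
Qed.

Lemma minor_coef_ge0 C U : C \subset U -> 0 <= minor_coef b j C U.
Proof.
move: C U; apply: edge_interval_ind => [U|C U e eU CU IHcon IHdel].
  by rewrite minor_coef_refl ler0n.
case: (boolP (conn U (ehead e) (etail e))) => he.
  by rewrite minor_coef_add_conn // addr_ge0.
case: (boolP (balanced U b)) => bal.
  by rewrite minor_coef_bridge_balanced.
by rewrite minor_coef_bridge_unbalanced.
Qed.

End MinorCoef.

(** Deletion-contraction keeps the inequality at every non-bridge.  At a bridge
    both coefficients vanish or descend to the contraction together, except
    when only the smaller one vanishes, where nonnegativity suffices. *)
Lemma minor_coef_mono (A A' : zmodType) (b : {ffun V -> A}) (b' : {ffun V -> A'}) j :
  balanced setT b' ->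
  (forall U e, e \notin U -> spanning (e |: U) -> ~~ conn U (ehead e) (etail e) ->
     balanced U b' -> balanced U b) ->
  forall C U, C \subset U -> spanning U ->
    minor_coef b j C U <= minor_coef b' j C U.
Proof.
move=> bal' imp; apply: edge_interval_ind => [U sU|C U e eU CU IHcon IHdel sU].
  rewrite !minor_coef_refl (balanced_spanning sU bal').
  by case: balanced; rewrite ?ler0n.
case: (boolP (conn U (ehead e) (etail e))) => he.
  rewrite (minor_coef_add_conn b j eU CU he) (minor_coef_add_conn b' j eU CU he).
  rewrite lerD ?IHcon ?IHdel //.
  by apply/forallP=> e'; rewrite -(conn_add_conn he); apply/forallP: e'.
case: (boolP (balanced U b)) => bal.
  by rewrite minor_coef_bridge_balanced // minor_coef_ge0 ?(subset_trans CU) ?subsetUr.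
have unbal' : ~~ balanced U b' := contra (imp U e eU sU he) bal.
rewrite (minor_coef_bridge_unbalanced j eU CU bal).
by rewrite (minor_coef_bridge_unbalanced j eU CU unbal') IHcon.
Qed.

Lemma minor_coef_flow_poly (A : finZmodType) (b : {ffun V -> A}) i :
  (i <= cyclomatic G)%N ->
  minor_coef b (cyclomatic G - i) set0 setT =
  (-1) ^+ i * (flow_poly b)`_(cyclomatic G - i).
Proof.
rewrite cyclomaticE => ile; rewrite coef_flow_poly /minor_coef !mulr_sumr.
apply: eq_big => [T|T /and4P[_ _ _ /eqP nT]]; first by rewrite sub0set subsetT.
have parity : odd (ncomp setT + ncomp T) = odd (i + #|~: T|).
  have := nullityK T; have := nullityK setT; have := cardsC T.
  by rewrite cardsT; lia.
by rewrite -!exprD -[LHS]signr_odd parity signr_odd.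
Qed.

(** * From assignings to polynomials *)

(** The only place where the order between assignings enters. *)
Lemma balanced_bridge_side (A A' : finZmodType)
    (b : {ffun V -> A}) (b' : {ffun V -> A'}) U e :
  locally_zero_sum b ->
  (forall S, (assigning_of b S <= assigning_of b' S)%N) ->
  spanning (e |: U) -> ~~ conn U (ehead e) (etail e) ->
  balanced U b' -> balanced U b.
Proof.
move=> lzs le sU he /balancedP bal'.
have uX := uncut_component U (ehead e).
have tX : etail e \notin component U (ehead e) by rewrite inE.
have balU := balanced_spanning sU (balanced_setT lzs).
apply: (balanced_add_separating uX (component_id _ _) tX balU).
have := le (exist (fun X : {set V} => X \in Lambda G) _ (bridge_side_in_Lambda sU he)).
by rewrite !ffunE /= (bal' _ uX) eqxx leqn0 eqb0 negbK => /eqP.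
Qed.

Lemma flow_poly_coef_le (A A' : finZmodType)
    (b : {ffun V -> A}) (b' : {ffun V -> A'}) i :
  locally_zero_sum b -> locally_zero_sum b' ->
  (forall S, (assigning_of b S <= assigning_of b' S)%N) ->
  (i <= cyclomatic G)%N ->
  (-1) ^+ i * (flow_poly b)`_(cyclomatic G - i) <=
  (-1) ^+ i * (flow_poly b')`_(cyclomatic G - i).
Proof.
move=> lzs lzs' le ile; rewrite -!minor_coef_flow_poly //.
apply: minor_coef_mono; rewrite ?sub0set ?balanced_setT //.
  by move=> U e _ sU he; apply: balanced_bridge_side lzs le sU he.
by apply/forallP=> e; apply: conn_edge; rewrite in_setT.
Qed.

(** Kochol's theorem that the count of nowhere-zero flows depends on [b] only
    through its assigning: monotonicity applies in both directions. *)
Lemma flow_poly_assigning (A A' : finZmodType)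
    (b : {ffun V -> A}) (b' : {ffun V -> A'}) :
  locally_zero_sum b -> locally_zero_sum b' ->
  assigning_of b = assigning_of b' -> flow_poly b = flow_poly b'.
Proof.
move=> lzs lzs' eq_bb'; apply/polyP=> j.
have [jle|jgt] := leqP j (cyclomatic G); last first.
  by rewrite !nth_default // (leq_trans (size_flow_poly _)).
rewrite -(subKn jle); move: (cyclomatic G - j)%N (leq_subr j (cyclomatic G)) => i ile.
apply: (can_inj (signrMK i)); apply/le_anti/andP.
by split; apply: flow_poly_coef_le => // S; rewrite eq_bb'.
Qed.

(** Enlarging the group does not change which sums vanish. *)
Definition pad (A B : finZmodType) (b : {ffun V -> A}) : {ffun V -> A * B} :=
  [ffun v => (b v, 0)].

Lemma sum_pad (A B : finZmodType) (b : {ffun V -> A}) W :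
  \sum_(v in W) pad B b v = (\sum_(v in W) b v, 0).
Proof.
rewrite (big_morph (fun x => (x, 0) : A * B) (op1 := +%R) (id1 := 0)) //.
  by apply: eq_bigr => v _; rewrite ffunE.
by move=> x y; congr (_, _); rewrite addr0.
Qed.

Lemma sum_pad_eq0 (A B : finZmodType) (b : {ffun V -> A}) W :
  (\sum_(v in W) pad B b v == 0) = (\sum_(v in W) b v == 0).
Proof. by rewrite sum_pad xpair_eqE eqxx andbT. Qed.

(** An assigning realised over [A] is realised over groups of unboundedly many
    orders, namely the products [A * Z_n]; this determines the polynomial. *)
Lemma assigning_polyE (A : finZmodType) (b : {ffun V -> A}) :
  locally_zero_sum b -> assigning_poly (assigning_of b) = flow_poly b.
Proof.
move=> lzs; set p := assigning_poly _.
have [_ p_count] : is_assigning_poly (assigning_of b) p.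
  apply: epsilon_spec; exists (flow_poly b); split; first exact: size_flow_poly.
  by move=> A' b' lzs' eq_b'b; rewrite -(flow_poly_assigning lzs' lzs eq_b'b) flow_polyE.
pose k n : nat := (#|A| * n.+2)%N.
have agree n : p.[(k n)%:R] = (flow_poly b).[(k n)%:R].
  pose b' := pad 'I_n.+2 b.
  have lzs' : locally_zero_sum b'.
    by move: lzs; congr is_true; apply: eq_forallb => C; rewrite sum_pad_eq0.
  have eq_b'b : assigning_of b' = assigning_of b.
    by apply/ffunP=> X; rewrite !ffunE sum_pad_eq0.
  have <- : #|{: A * 'I_n.+2}| = k n by rewrite card_prod card_ord.
  by rewrite (p_count _ _ lzs' eq_b'b) -(flow_poly_assigning lzs' lzs eq_b'b) flow_polyE.
apply/eqP; rewrite -subr_eq0; apply/eqP; set q := p - _.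
apply: (@roots_geq_poly_eq0 _ q [seq (k n)%:R | n <- iota 0 (size q)]).
- by apply/allP=> _ /mapP[n _ ->]; rewrite /root /q hornerD hornerN agree subrr.
- have A0 : (0 < #|A|)%N by apply/card_gt0P; exists 0.
  rewrite map_inj_uniq ?iota_uniq // => n n' /eqP.
  by rewrite eqr_nat eqn_pmul2l // => /eqP[].
- by rewrite size_map size_iota.
Qed.

Lemma signless_coef_le (A A' : finZmodType)
    (b : {ffun V -> A}) (b' : {ffun V -> A'}) i :
  locally_zero_sum b -> locally_zero_sum b' ->
  (forall S, (assigning_of b S <= assigning_of b' S)%N) ->
  (i <= cyclomatic G)%N ->
  signless_coef (assigning_of b) i <= signless_coef (assigning_of b') i.
Proof.
by move=> lzs lzs' le ile; rewrite /signless_coef !assigning_polyE // flow_poly_coef_le.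
Qed.

End SpanningSubgraphs.

Theorem theorem1p6 (G : mgraph) :
  (forall (alpha alpha' : assigning G) (A A' : finZmodType)
          (b : {ffun vertex G -> A}) (b' : {ffun vertex G -> A'}),
     locally_zero_sum b -> locally_zero_sum b' ->
     alpha = assigning_of b -> alpha' = assigning_of b' ->
     (forall X : {X : {set vertex G} | X \in Lambda G},
        (alpha X <= alpha' X)%N) ->
     forall i : nat, (i <= cyclomatic G)%N ->
       signless_coef alpha i <= signless_coef alpha' i)
  /\
  (forall (A : finZmodType) (b : {ffun vertex G -> A}),
     locally_zero_sum b ->
     forall i : nat, (i <= cyclomatic G)%N ->
       signless_coef (assigning0 G) i <= signless_coef (assigning_of b) i).
Proof.
split=> [alpha alpha' A A' b b' lzs lzs' -> -> le i ile | A b lzs i ile].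
  exact: signless_coef_le.
pose z : {ffun vertex G -> A} := [ffun=> 0].
have z0 (W : {set vertex G}) : \sum_(v in W) z v = 0.
  by apply: big1 => v _; rewrite ffunE.
have lzsz : locally_zero_sum z by apply/forall_inP=> C _; rewrite z0.
have -> : assigning0 G = assigning_of z.
  by apply/ffunP=> X; rewrite !ffunE z0 eqxx.
by apply: signless_coef_le => // X; rewrite ffunE z0 eqxx.
Qed.
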